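(* Let $T\in\mathcal{GB}(H)$ and let $\Lambda_T=\{(W_j,\Lambda_j,w_j)\}_{j\in J}$ be a $(T,T)$-controlled $g$-fusion Bessel sequence in $H$. Then $\Lambda_T$ is a $(T,T)$-controlled $g$-fusion frame for $H$ if and only if there exist an operator $U\in\mathcal{GB}(H)$ and a $(U,U)$-controlled $g$-fusion Bessel sequence $\Gamma_U=\{(V_j,\Gamma_j,v_j)\}_{j\in J}$ in $H$ such that $S_{U\Gamma\Lambda T}\ge m\,I_H$ for some $m>0$.
   Context: $H$ is a separable Hilbert space with identity operator $I_H$, $J\subset\mathbb{Z}$, $\{H_j\}_{j\in J}$ is a collection of Hilbert spaces, $W_j,V_j\subset H$ are closed subspaces, $w_j,v_j>0$ are weights, and $\Lambda_j,\Gamma_j\in\mathcal{B}(H,H_j)$ (bounded linear operators). $\mathcal{GB}(H)$ is the set of bounded linear operators on $H$ having a bounded inverse. $P_M$ is the orthogonal projection onto a closed subspace $M$. For $R\in\mathcal{GB}(H)$, a family $\{(M_j,\Theta_j,u_j)\}_{j\in J}$ ($M_j\subset H$ closed subspaces, $\Theta_j\in\mathcal{B}(H,H_j)$, $u_j>0$) is an $(R,R)$-controlled $g$-fusion frame for $H$ if there are $0<a\le b<\infty$ with $$a\|f\|^2\le\sum_{j\in J}u_j^2\langle\Theta_jP_{M_j}Rf,\Theta_jP_{M_j}Rf\rangle\le b\|f\|^2\quad\text{for all } f\in H;$$ it is an $(R,R)$-controlled $g$-fusion Bessel sequence with bound $b$ if the right-hand inequality holds. For a $(T,T)$-controlled Bessel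 sequence $\Lambda_T=\{(W_j,\Lambda_j,w_j)\}_{j\in J}$ and a $(U,U)$-controlled Bessel sequence $\Gamma_U=\{(V_j,\Gamma_j,v_j)\}_{j\in J}$, the frame operator of the pair $\Gamma_U,\Lambda_T$ is the bounded operator $$S_{U\Gamma\Lambda T}f=\sum_{j\in J}v_jw_jU^*P_{V_j}\Gamma_j^*\Lambda_jP_{W_j}Tf,\quad f\in H.$$ The order $\le$ is the usual partial order on self-adjoint operators on $H$: $R\le S$ iff $\langle Rf,f\rangle\le\langle Sf,f\rangle$ for all $f\in H$. *)

(* Defs.v *)
From HB Require Import structures.
From mathcomp Require Import all_boot all_order all_algebra.
From mathcomp Require Import complex.
From mathcomp Require Import all_classical all_reals topology normedtype.
From mathcomp.analysis.showcase Require summability.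

Set Implicit Arguments.
Unset Strict Implicit.
Unset Printing Implicit Defensive.

Import Order.TTheory GRing.Theory Num.Theory.
Import numFieldNormedType.Exports.

Local Open Scope classical_set_scope.
Local Open Scope ring_scope.

(* Hilbert spaces are real or complex.  Both scalar fields are numFieldTypes,
   and the order of R[i] is the partial one (x <= y iff y - x is a nonnegative
   real), so that an inequality between scalars asserts in particular that
   their difference is real, and 0 < w that w is a positive real. *)
Variant scalar_kind := RealScalars | ComplexScalars.

Definition scalars (R : realType) (k : scalar_kind) : numFieldType :=
  match k with
  | RealScalars => R
  | ComplexScalars => R[i]%C
  end.

Definition scalar_conj (R : realType) (k : scalar_kind) :
    scalars R k -> scalars R k :=
  match k with
  | RealScalars => idfun
  | ComplexScalars => @Num.conj R[i]%C
  end.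

(* The inner product is linear in its first argument.  The norm of the
   underlying complete normed module takes its values in the scalar field. *)
Record hilbert (R : realType) (k : scalar_kind) := Hilbert {
  hilbert_space :> completeNormedModType (scalars R k);
  inner : {dot hilbert_space for @scalar_conj R k};
  inner_norm : forall x : hilbert_space, `|x| ^+ 2 = inner x x
}.

Notation "''[' x , y ]" := (inner _ x y)
  (at level 0, format "''[' x ,  y ]") : ring_scope.

Definition separable (T : topologicalType) :=
  exists2 D : set T, countable D & dense D.

Section Operators.
Variables (R : realType) (k : scalar_kind).
Local Notation K := (scalars R k).
Implicit Types H : hilbert R k.

Definition bounded_linear H1 H2 (A : H1 -> H2) :=
  linear A /\ exists c : K, forall x, `|A x| <= c * `|x|.

(* the set GB(H) *)
Definition boundedly_invertible H (A : H -> H) :=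
  bounded_linear A /\
  exists B : H -> H, [/\ bounded_linear B, cancel A B & cancel B A].

Definition closed_subspace H (M : set H) :=
  closed M /\ submod_closed [in M].

(* The defining condition determines y uniquely, and such a y exists when M is
   a closed subspace; otherwise the value may be 0. *)
Definition orth_proj H (M : set H) (x : H) : H :=
  xget 0 [set y | M y /\ forall z, M z -> '[x - y, z] = 0].

(* Similarly, existence holds when A is bounded and linear. *)
Definition adjoint H1 H2 (A : H1 -> H2) (y : H2) : H1 :=
  xget 0 [set z | forall x, '[A x, y] = '[x, z]].

Definition self_adjoint H (A : H -> H) :=
  bounded_linear A /\ adjoint A =1 A.

Definition op_le H (A B : H -> H) :=
  [/\ self_adjoint A, self_adjoint B &
      forall f, '[A f, f] <= '[B f, f]].

(* Convergence of the net of finite partial sums (unconditional convergence). *)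
Definition has_sum (I : choiceType) (V : normedModType K) (x : I -> V) (s : V) :=
  summability.partial_sum x @ summability.totally --> s.

Record gfusion_family (I : choiceType) H (Hj : I -> hilbert R k) :=
  GFusionFamily {
    gf_space : I -> set H;
    gf_op : forall j, H -> Hj j;
    gf_weight : I -> K;
    gf_space_closed : forall j, closed_subspace (gf_space j);
    gf_op_bounded : forall j, bounded_linear (gf_op j);
    gf_weight_gt0 : forall j, 0 < gf_weight j
  }.

Section Families.
Variables (I : choiceType) (H : hilbert R k) (Hj : I -> hilbert R k).
Implicit Types (F G : gfusion_family H Hj) (T U : H -> H).

(* gf_image F T j f is Theta_j (P_{M_j} (T f)) *)
Definition gf_image F T j (f : H) : Hj j :=
  gf_op F j (orth_proj (gf_space F j) (T f)).

Definition gf_quad F T (f : H) (j : I) : K :=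
  gf_weight F j ^+ 2 * '[gf_image F T j f, gf_image F T j f].

Definition controlled_bessel F T :=
  exists2 b : K, 0 < b &
    forall f, exists2 s : K, has_sum (gf_quad F T f : I -> K^o) s &
      s <= b * `|f| ^+ 2.

Definition controlled_frame F T :=
  exists a b : K, [/\ 0 < a, a <= b &
    forall f, exists2 s : K, has_sum (gf_quad F T f : I -> K^o) s &
      a * `|f| ^+ 2 <= s <= b * `|f| ^+ 2].

(* The series converges when F is T-controlled Bessel and G is U-controlled
   Bessel; in general the limit may be a default value. *)
Definition frame_operator G U F T (f : H) : H :=
  summability.sum (fun j => (gf_weight G j * gf_weight F j) *:
    adjoint U (orth_proj (gf_space G j)
      (adjoint (gf_op G j) (gf_image F T j f)))).

End Families.
End Operators.

(* Main.v *)
(* The term U* P_V Gamma* Lambda P_W T f of the frame operator is characterized by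
   its inner products with g, namely <Lambda P_W T f, Gamma P_V U g>.  With c the
   Bessel bound of Gamma_U and q_A(f) the partial sum over A of the quadratic form
   of Lambda_T, AM-GM gives, for every t > 0 and every finite A,
     2 |<S_A f, g>| <= q_A(f) / t + t c |g|^2.
   With g = S_A f and t = 1/c this is |S_A f|^2 <= c q_A(f), so the net S_A f is
   Cauchy.  In the limit, with g = f, t = m/c and S >= m I, it yields the lower
   frame bound m^2/c.  Conversely, Gamma_U = Lambda_T works: then <S f, f> is the
   frame sum itself. *)
Require Import Defs.
From mathcomp Require Import all_boot all_order all_algebra finmap complex.
From mathcomp Require Import all_classical all_reals topology normedtype.
From mathcomp.analysis.showcase Require summability.
From mathcomp Require Import ring.
Set Implicit Arguments.
Unset Strict Implicit.
Unset Printing Implicit Defensive.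
Import Order.TTheory GRing.Theory Num.Theory.
Import numFieldNormedType.Exports.
Local Open Scope classical_set_scope.
Local Open Scope ring_scope.
#[local] Existing Instance summability.totally_filter.

(** * Conjugation and infima in the real or complex scalar field *)

Section Scalars.
Variables (R : realType) (k : scalar_kind).
Local Notation K := (scalars R k).
Local Notation conj := (@scalar_conj R k).

Lemma scalar_conjK : involutive conj.
Proof. by case: k => x //=; rewrite conjCK. Qed.

Lemma scalar_conjM : {morph conj : x y / x * y}.
Proof. by case: k => x y //=; rewrite rmorphM. Qed.

Lemma scalar_conjD : {morph conj : x y / x + y}.
Proof. by case: k => x y //=; rewrite rmorphD. Qed.

Lemma ger0_scalar_conj (x : K) : 0 <= x -> conj x = x.
Proof. by case: k x => //= x x0; apply: geC0_conj. Qed.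

Lemma norm_scalar_conj (x : K) : `|conj x| = `|x|.
Proof. by case: k x => //= x; rewrite norm_conjC. Qed.

Lemma mul_scalar_conj (x : K) : x * conj x = `|x| ^+ 2.
Proof.
case: k x => /= x; last by rewrite normCK.
by rewrite real_normK ?num_real// expr2.
Qed.

(* The scalars are only partially ordered, but a set of nonnegative scalars
   consists of reals. *)
Lemma nonneg_inf_exists (E : set K) : E !=set0 -> (forall x, E x -> 0 <= x) ->
  exists d : K, (forall x, E x -> d <= x) /\
    forall e, 0 < e -> exists2 x, E x & x < d + e.
Proof.
have real_case (F : set R) : F !=set0 -> (forall x, F x -> 0 <= x) ->
    (forall x, F x -> inf F <= x) /\
    forall e, 0 < e -> exists2 x, F x & x < inf F + e.
  move=> F0 Fge0.
  have lbF : has_lbound F by exists 0 => x /Fge0.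
  split.
  - by move=> x Fx; exact: ge_inf.
  - by move=> e e0; apply: inf_adherent.
case: k E => /= E [x0 Ex0] Ege0.
  by exists (inf E); apply: real_case => //; exists x0.
have ReE x : E x -> x = (complex.Re x)%:C%C by move=> /Ege0 /ger0_real /RRe_real.
pose F := [set complex.Re x | x in E].
have [||dle dadh] := real_case F.
- by exists (complex.Re x0), x0.
- by move=> _ [x Ex <-]; rewrite -lecR -ReE//; apply: Ege0.
exists (inf F)%:C%C; split.
- by move=> x Ex; rewrite (ReE _ Ex) lecR; apply: dle; exists x.
- move=> e e0; have /RRe_real ee := gtr0_real e0.
  move: e0; rewrite -ee ltcR => e0.
  have [_ [x Ex <-] xlt] := dadh _ e0.
  by exists x => //; rewrite (ReE _ Ex) -rmorphD/= ltcR.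
Qed.

End Scalars.

(** * Limit arguments and elementary inequalities in a partially ordered field *)

Section NumField.
Variable K : numFieldType.
Implicit Types c x y : K.

Lemma eps_eq0 c : (forall e, 0 < e -> `|c| <= e) -> c = 0.
Proof.
move=> ce; apply/eqP; apply: contrapT => /negP c0.
have := ce (`|c| / 2); rewrite divr_gt0 ?normr_gt0// => /(_ isT).
by rewrite ler_pdivlMr// ger_pMr ?normr_gt0// lern1.
Qed.

Lemma eps_eq0_mul c x : 0 <= x -> (forall e, 0 < e -> `|c| <= e * x) -> c = 0.
Proof.
move=> x0 cx; apply: eps_eq0 => e e0.
have x1 : 0 < x + 1 by rewrite ltr_wpDl.
(* Dividing by [x + 1] rather than [x] covers the case [x = 0]. *)
apply: le_trans (cx (e / (x + 1)) _) _; first by rewrite divr_gt0.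
by rewrite -mulrA ger_pMr// ler_pdivrMl// mulr1 lerDl.
Qed.

(** In a partial order [c < 0] is not the negation of [0 <= c], so the proof shows [c = |c|]
    instead: [c - |c|] lies within [2 * e * y] of [x - |x| = 0]. *)
Lemma eps_ge0_mul c y : 0 <= y ->
  (forall e, 0 < e -> exists2 x, 0 <= x & `|c - x| <= e * y) -> 0 <= c.
Proof.
move=> y0 ce; suff -> : c = `|c| by [].
apply/eqP; rewrite -subr_eq0; apply/eqP.
apply: (@eps_eq0_mul _ (2 * y)) => [|e e0]; first by rewrite mulr_ge0.
have [x x0 cx] := ce _ e0.
have -> : c - `|c| = (c - x) - (`|c| - `|x|) by rewrite (ger0_norm x0); ring.
rewrite (le_trans (ler_normB _ _))// mulrCA mulr_natl mulr2n lerD//.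
by rewrite (le_trans (ler_dist_dist _ _)).
Qed.

Lemma eps_ge0 c :
  (forall e, 0 < e -> exists2 x, 0 <= x & `|c - x| <= e) -> 0 <= c.
Proof.
move=> ce; apply: (@eps_ge0_mul _ 1) => // e /ce[x x0 cx].
by exists x; rewrite ?mulr1.
Qed.

(** The difference of the two sides is [t^-1 * (x - t * y) ^+ 2], which is nonnegative because
    [x - t * y] is real. *)
Lemma amgm2 x y t : 0 <= x -> 0 <= y -> 0 < t ->
  2 * (x * y) <= t^-1 * x ^+ 2 + t * y ^+ 2.
Proof.
move=> x0 y0 t0; rewrite -subr_ge0.
have -> : t^-1 * x ^+ 2 + t * y ^+ 2 - 2 * (x * y) = t^-1 * (x - t * y) ^+ 2.
  by field; rewrite gt_eqF.
rewrite mulr_ge0 ?invr_ge0 ?(ltW t0)// real_exprn_even_ge0//.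
by rewrite realB// ger0_real// mulr_ge0// ltW.
Qed.

(** The arithmetic behind [minimizers_close]: [p] and [q] are squared distances from a point to two
    near-minimizers, [m] is the one to their midpoint, and [s] is the squared distance between the
    two. *)
Lemma midpoint_bound d e p q m s : 2 ^+ 2 * m + s = 2 * p + 2 * q :> K ->
  d <= m -> p <= d + e -> q <= d + e -> s <= 4 * e.
Proof.
move=> /(canRL (addKr _)) -> dm pd qd; rewrite -subr_ge0.
have -> : 4 * e - (- (2 ^+ 2 * m) + (2 * p + 2 * q)) =
  2 * ((d + e) - p) + 2 * ((d + e) - q) + 4 * (m - d) by ring.
by rewrite !addr_ge0// mulr_ge0// subr_ge0.
Qed.

End NumField.

(** * Inner product identities and the Cauchy-Schwarz inequality *)

Section InnerProduct.
Variables (R : realType) (k : scalar_kind).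
Local Notation K := (scalars R k).
Local Notation conj := (@scalar_conj R k).
Variable H : hilbert R k.
Implicit Types x y z : H.

Lemma innerDl x y z : '[x + y, z] = '[x, z] + '[y, z].
Proof. exact: linearDl. Qed.

Lemma innerBl x y z : '[x - y, z] = '[x, z] - '[y, z].
Proof. exact: linearBl. Qed.

Lemma innerZl (a : K) x y : '[a *: x, y] = a * '[x, y].
Proof. exact: linearZl_LR. Qed.

Lemma innerDr x y z : '[x, y + z] = '[x, y] + '[x, z].
Proof. exact: linearDr. Qed.

Lemma innerBr x y z : '[x, y - z] = '[x, y] - '[x, z].
Proof. exact: linearBr. Qed.

Lemma inner0r x : '[x, 0] = 0.
Proof. exact: linear0r. Qed.

Lemma innerZr (a : K) x y : '[x, a *: y] = conj a * '[x, y].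
Proof. exact: linearZr_LR. Qed.

Lemma innerC x y : '[x, y] = conj '[y, x].
Proof.
have := @hermitian_subproof _ _ _ _ (inner H) x y.
by rewrite expr0 mul1r.
Qed.

Lemma norm_innerC x y : `|'[x, y]| = `|'[y, x]|.
Proof. by rewrite innerC norm_scalar_conj. Qed.

Lemma inner_eq0C x y : '[x, y] = 0 -> '[y, x] = 0.
Proof. by move=> xy; apply/normr0_eq0; rewrite norm_innerC xy normr0. Qed.

Lemma inner_suml I (r : seq I) (f : I -> H) y :
  '[\sum_(i <- r) f i, y] = \sum_(i <- r) '[f i, y].
Proof. exact: linear_sumlz. Qed.

Lemma inner_ext x y : (forall z, '[x, z] = '[y, z]) -> x = y.
Proof.
move=> xy; apply/eqP; rewrite -subr_eq0 -normr_eq0 -sqrf_eq0 inner_norm.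
by rewrite innerBl xy subrr.
Qed.

Lemma parallelogram x y :
  `|x + y| ^+ 2 + `|x - y| ^+ 2 = 2 * `|x| ^+ 2 + 2 * `|y| ^+ 2.
Proof.
by rewrite !inner_norm innerBl !innerBr innerDl !innerDr; ring.
Qed.

(** Pythagoras: the component of [x] along [z] is removed. Nonnegativity of the left side is
    Cauchy-Schwarz, and the exact decrease drives [almost_orthogonal]. *)
Lemma norm2_sub_proj x z : z != 0 ->
  `|x - ('[x, z] / `|z| ^+ 2) *: z| ^+ 2 =
  `|x| ^+ 2 - `|'[x, z]| ^+ 2 / `|z| ^+ 2.
Proof.
move=> z0; have n0 : `|z| != 0 by rewrite normr_eq0.
rewrite inner_norm innerBl !innerBr !innerZl !innerZr -!inner_norm.
rewrite -mul_scalar_conj scalar_conjM (innerC z x).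
rewrite [conj (_^-1)]ger0_scalar_conj; last by rewrite invr_ge0 exprn_ge0.
rewrite divfK ?expf_neq0// subrr subr0.
by rewrite mulrAC [in LHS](mulrC (conj _)).
Qed.

Lemma cauchy_schwarz x y : `|'[x, y]| <= `|x| * `|y|.
Proof.
have [->|y0] := eqVneq y 0; first by rewrite inner0r !normr0 mulr0.
rewrite -ler_sqr ?nnegrE ?mulr_ge0// exprMn.
have n0 : 0 < `|y| ^+ 2 by rewrite exprn_gt0 ?normr_gt0.
rewrite -ler_pdivrMr// -subr_ge0 -norm2_sub_proj//.
by rewrite exprn_ge0.
Qed.

Lemma norm_inner_le_l x y (e : K) : `|x| <= e -> `|'[x, y]| <= e * `|y|.
Proof. by move=> xe; rewrite (le_trans (cauchy_schwarz _ _))// ler_wpM2r. Qed.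

Lemma norm_inner_le_r x y (e : K) : `|y| <= e -> `|'[x, y]| <= e * `|x|.
Proof. by rewrite norm_innerC; exact: norm_inner_le_l. Qed.

End InnerProduct.

(** * Orthogonal projection onto a closed subspace *)

Section Projection.
Variables (R : realType) (k : scalar_kind).
Local Notation K := (scalars R k).
Variable H : hilbert R k.
Variable M : set H.
Hypothesis closedM : closed_subspace M.
Implicit Types x y z : H.

Let M0 : M 0.
Proof. by have [_ [+ _]] := closedM; rewrite inE. Qed.

Let MP (a : K) y z : M y -> M z -> M (a *: y + z).
Proof.
have [_ [_ lin]] := closedM.
by move=> My Mz; have := lin a y z; rewrite !inE; apply.
Qed.

(** Moving [y] inside [M] by the best multiple of [z] lowers the squared distance to [x] by
    [|<x - y, z>|^2 / |z|^2]. The result stays at least [d], so this gain is at most [e]. *)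
Lemma almost_orthogonal x y z (d e : K) : M y -> M z ->
  (forall y', M y' -> d <= `|x - y'| ^+ 2) -> `|x - y| ^+ 2 <= d + e ->
  `|'[x - y, z]| ^+ 2 <= e * `|z| ^+ 2.
Proof.
move=> My Mz dle dadh.
have [->|z0] := eqVneq z 0; first by rewrite inner0r !normr0 expr0n/= mulr0.
have n0 : 0 < `|z| ^+ 2 by rewrite exprn_gt0 ?normr_gt0.
rewrite -ler_pdivrMr//.
have := dle _ (MP ('[x - y, z] / `|z| ^+ 2) Mz My).
rewrite opprD addrCA addrC norm2_sub_proj// lerBrDr => h.
by rewrite -(lerD2l d) (le_trans h).
Qed.

(** The midpoint of [y] and [y'] lies in [M], hence has squared distance at least [d] from [x]; the
    parallelogram law then leaves little room between [y] and [y']. *)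
Lemma minimizers_close x y y' (d e : K) : M y -> M y' ->
  (forall y', M y' -> d <= `|x - y'| ^+ 2) ->
  `|x - y| ^+ 2 <= d + e -> `|x - y'| ^+ 2 <= d + e ->
  `|y' - y| ^+ 2 <= 4 * e.
Proof.
move=> My My' dle dy dy'.
have := dle _ (MP 2^-1 My (MP 2^-1 My' M0)); rewrite addr0 => dm.
have := parallelogram (x - y) (x - y').
have -> : x - y + (x - y') = 2 *: (x - (2^-1 *: y + 2^-1 *: y')).
  rewrite scalerBr scalerDr !scalerA divff ?pnatr_eq0// !scale1r.
  by rewrite scaler_nat mulr2n addrACA opprD.
have -> : x - y - (x - y') = y' - y by rewrite opprB addrC addrA subrK.
rewrite normrZ exprMn ger0_norm// => eqs.
exact: midpoint_bound eqs dm dy dy'.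
Qed.

(** Near-minimizers of the distance to [x] form a Cauchy filter by [minimizers_close]. Its limit
    lies in [M] by closedness, and the near-orthogonality of the near-minimizers becomes
    orthogonality in the limit. *)
Lemma projection_exists x : exists y, M y /\ forall z, M z -> '[x - y, z] = 0.
Proof.
have [||d [dle dadh]] := @nonneg_inf_exists R k [set `|x - y| ^+ 2 | y in M].
- by exists (`|x - 0| ^+ 2), 0.
- by move=> _ [y _ <-]; rewrite exprn_ge0.
have {}dle y : M y -> d <= `|x - y| ^+ 2 by move=> My; apply: dle; exists y.
(* A numFieldType need not be archimedean, so the near-minimizers are
   indexed by all positive scalars rather than taken as a sequence. *)
pose B (e : K) := [set y | M y /\ `|x - y| ^+ 2 <= d + e].
pose F := filter_from [set e : K | 0 < e] B.
have PF : ProperFilter F.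
  apply: filter_from_proper; last first.
    by move=> e /dadh[_ [y My <-] /ltW]; exists y.
  apply: filter_from_filter; first by exists 1; exact: ltr01.
  move=> e e' e0 e0'.
  (* Positive scalars are real, hence comparable, so the minimum makes sense. *)
  have es : e >=< e' by rewrite real_comparable// gtr0_real.
  exists (Order.min e e').
    by rewrite /= comparable_lt_min// e0.
  have le1 : Order.min e e' <= e by rewrite comparable_ge_min// lexx.
  have le2 : Order.min e e' <= e' by rewrite comparable_ge_min// lexx orbT.
  by move=> y [My yd]; split; split=> //; apply: le_trans yd _; rewrite lerD2l.
have cF : cauchy F.
  apply: cauchy_exP => e e0.
  (* [minimizers_close] turns this excess into a squared distance of at most [e ^+ 2 / 2]. *)
  have e'0 : 0 < e ^+ 2 / 8 by rewrite divr_gt0 ?exprn_gt0.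
  have [_ [y My <-] /ltW yd] := dadh _ e'0.
  exists y, (e ^+ 2 / 8) => // y' [My' yd']; rewrite -ball_normE/= distrC.
  rewrite -ltr_sqr ?nnegrE ?(ltW e0)//.
  apply: le_lt_trans (minimizers_close My My' dle yd yd') _.
  by rewrite mulrCA gtr_pMr ?exprn_gt0// ltr_pdivrMr// mul1r ltr_nat.
have /cvg_ex[/= y Fy] := @cauchy_cvg _ F PF cF.
(* The excess is [e ^+ 2] so that [almost_orthogonal] yields [|<x - y', z>| <= e * |z|], the same
   order as the error [|y - y'|]. *)
have nearF (e : K) : 0 < e ->
    exists y', [/\ M y', `|x - y'| ^+ 2 <= d + e ^+ 2 & `|y - y'| < e].
  move=> e0; have e20 : 0 < e ^+ 2 by rewrite exprn_gt0.
  have : F (B (e ^+ 2)) by exists (e ^+ 2).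
  have : F (ball y e) by apply: Fy; apply: nbhsx_ballx.
  move=> F1 F2; have [y' [y1 [My' y2]]] := filter_ex (filterI F1 F2).
  by exists y'; split=> //; rewrite -ball_normE in y1.
exists y; split.
  have [cM _] := closedM; apply: cM => A /nbhs_ballP[e/= e0 eA].
  have [y' [My' _ yy']] := nearF _ e0; exists y'; split=> //.
  by apply: eA; rewrite -ball_normE.
move=> z Mz; apply: (@eps_eq0_mul _ _ (2 * `|z|)); first by rewrite mulr_ge0.
move=> e e0; have [y' [My' yd yy']] := nearF _ e0.
have -> : x - y = (x - y') - (y - y') by rewrite opprB addrA subrK.
rewrite innerBl (le_trans (ler_normB _ _))//.
have -> : e * (2 * `|z|) = e * `|z| + e * `|z| by rewrite mulr_natl mulr2n mulrDr.
rewrite lerD//.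
  rewrite -ler_sqr ?nnegrE ?mulr_ge0// ?(ltW e0)// exprMn.
  exact: almost_orthogonal yd.
by apply: norm_inner_le_l; exact: ltW.
Qed.

Lemma orth_projP x :
  M (orth_proj M x) /\ forall z, M z -> '[x - orth_proj M x, z] = 0.
Proof. exact: (xgetPex 0 (projection_exists x)). Qed.

(** Both sides equal the inner product of the two projections. *)
Lemma orth_proj_sym x y : '[orth_proj M x, y] = '[x, orth_proj M y].
Proof.
have [Mx ox] := orth_projP x; have [My oy] := orth_projP y.
transitivity '[orth_proj M x, orth_proj M y].
  apply/eqP; rewrite -subr_eq0 -innerBr; apply/eqP/inner_eq0C; exact: oy.
by apply/eqP; rewrite eq_sym -subr_eq0 -innerBl; apply/eqP; exact: ox.
Qed.

End Projection.

(** * Riesz representation, adjoints and self-adjointness *)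

Section Adjoint.
Variables (R : realType) (k : scalar_kind).
Local Notation K := (scalars R k).
Implicit Types H : hilbert R k.

(** For [x0] outside the kernel, [u = x0 - P x0] is orthogonal to the kernel, which contains
    [x - (phi x / phi u) u] for every [x]. Hence [<x, u> = (phi x / phi u) |u|^2], and a multiple of
    [u] represents [phi]. *)
Lemma riesz H (phi : H -> K) :
  (forall (a : K) x y, phi (a *: x + y) = a * phi x + phi y) ->
  (exists c : K, forall x, `|phi x| <= c * `|x|) ->
  exists z, forall x, phi x = '[x, z].
Proof.
move=> lin [c0 bnd0].
(* On the zero space the given constant need not be nonnegative, so its modulus replaces it. *)
have [c c_ge0 bnd] : exists2 c : K, 0 <= c & forall x, `|phi x| <= c * `|x|.
  exists `|c0| => // x; have b0 := bnd0 x.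
  by rewrite -[X in _ * X]normr_id -normrM ger0_norm// (le_trans _ b0).
have phiB x y : phi (x - y) = phi x - phi y.
  by rewrite addrC -scaleN1r lin mulN1r addrC.
have phi0 : phi 0 = 0 by rewrite -(subrr 0) phiB subrr.
have [phi_0|] := pselect (forall x, phi x = 0).
  by exists 0 => x; rewrite inner0r.
move=> /existsNP[x0 phix0].
have kerM : closed_subspace [set x | phi x = 0].
  split; last first.
    split; first by rewrite inE.
    by move=> a x y; rewrite !inE/= lin => -> ->; rewrite mulr0 addr0.
  move=> x clx; apply: (eps_eq0_mul c_ge0) => e e0.
  have [y [/= phiy xy]] := clx _ (nbhsx_ballx x e e0).
  rewrite -[phi x]subr0 -phiy -phiB (le_trans (bnd _))// mulrC ler_wpM2r//.
  by move: xy; rewrite -ball_normE => /ltW.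
have [/= Mp op] := orth_projP kerM x0.
set u := x0 - _ in op.
have phiu : phi u != 0 by rewrite phiB Mp subr0; apply/eqP.
have nu : `|u| ^+ 2 != 0.
  by rewrite expf_neq0// normr_eq0; apply: contraNneq phiu => ->; rewrite phi0.
(* The coefficient is conjugated because the second argument of the inner product is
   conjugate-linear. *)
exists (scalar_conj (phi u / `|u| ^+ 2) *: u) => x.
have /op/inner_eq0C : phi (- (phi x / phi u) *: u + x) = 0.
  by rewrite lin mulNr divfK// addNr.
rewrite innerDl innerZl mulNr => /eqP; rewrite addrC subr_eq0 => /eqP xu.
by rewrite innerZr scalar_conjK xu -inner_norm mulrA mulrAC divfK// mulrC divfK.
Qed.

Lemma adjointP H1 H2 (A : H1 -> H2) (x : H1) (y : H2) :
  bounded_linear A -> '[A x, y] = '[x, adjoint A y].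
Proof.
move=> [lin [c bnd]].
have [z zP] : exists z, forall x, '[A x, y] = '[x, z].
  apply: riesz => [a x1 x2|]; first by rewrite lin innerDl innerZl.
  exists (c * `|y|) => x1; rewrite (le_trans (cauchy_schwarz _ _))//.
  by rewrite mulrAC ler_wpM2r.
have /(xgetPex 0) : exists z, forall x, '[A x, y] = '[x, z] by exists z.
exact.
Qed.

Lemma adjointPr H1 H2 (A : H1 -> H2) (x : H1) (y : H2) :
  bounded_linear A -> '[adjoint A y, x] = '[y, A x].
Proof. by move=> bA; rewrite innerC -adjointP// -innerC. Qed.

Lemma self_adjointP H (A : H -> H) : bounded_linear A ->
  (forall x y, '[A x, y] = '[x, A y]) -> self_adjoint A.
Proof.
move=> bA sA; split=> // y; apply: inner_ext => x.
by rewrite adjointPr// sA.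
Qed.

Lemma scale_self_adjoint H (m : K) : 0 <= m ->
  self_adjoint (fun f : H => m *: f).
Proof.
move=> m0; apply: self_adjointP => [|x y].
  split=> [a x y|]; first by rewrite scalerDr !scalerA mulrC.
  by exists m => x; rewrite normrZ ger0_norm.
by rewrite innerZl innerZr ger0_scalar_conj.
Qed.

(** Symmetry moves the projection onto the test vector [z], where linearity of the inner product
    suffices. *)
Lemma orth_proj_linear H (M : set H) : closed_subspace M ->
  linear (orth_proj M).
Proof.
move=> cM a x y; apply: inner_ext => z.
by rewrite innerDl innerZl !orth_proj_sym// innerDl innerZl.
Qed.

End Adjoint.

(** * Partial sums over finite sets *)

Section PartialSums.
Variable I : choiceType.
Implicit Types A B : {fset I}.
Local Open Scope fset_scope.

Lemma partial_sumE (V : zmodType) (x : I -> V) A :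
  summability.partial_sum x A = (\sum_(i <- A) x i)%R.
Proof. by rewrite big_seq_fsetE. Qed.

(** Increments of the net are again partial sums, so an estimate valid for every finite set also
    controls the Cauchy differences. *)
Lemma partial_sum_setD (V : zmodType) (x : I -> V) A B : A `<=` B ->
  (summability.partial_sum x B - summability.partial_sum x A)%R =
  summability.partial_sum x (B `\` A).
Proof.
move=> /fsubsetP AB; apply/eqP; rewrite subr_eq addrC !partial_sumE -big_cat.
apply/eqP; apply: perm_big; apply: uniq_perm.
- exact: fset_uniq.
- rewrite cat_uniq !fset_uniq andbT/=; apply/hasPn => i.
  by rewrite inE => /andP[].
- move=> i; rewrite mem_cat inE.
  by have [/AB|] := boolP (i \in A).
Qed.

Lemma has_sum_near (K : numFieldType) (V : normedModType K) (x : I -> V) (s : V)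
    (e : K) :
  summability.partial_sum x @ summability.totally --> s -> (0 < e)%R ->
  exists A, forall B, A `<=` B -> (`|s - summability.partial_sum x B| < e)%R.
Proof. by move=> /cvgrPdist_lt xs /xs[A _ AB]; exists A => B; apply: AB. Qed.

End PartialSums.

(** * Unconditional sums of nonnegative scalars *)

Section HasSum.
Variables (K : numFieldType) (I : choiceType) (x : I -> K) (s : K).
Hypotheses (x_ge0 : forall i, 0 <= x i)
  (xs : summability.partial_sum (x : I -> K^o) @ summability.totally --> (s : K^o)).
Implicit Types A B : {fset I}.

Lemma has_sum_scalar_near (e : K) : 0 < e -> exists A, forall B,
  (A `<=` B)%fset -> `|s - summability.partial_sum x B| < e.
Proof. exact: has_sum_near xs. Qed.

(** For large [B], the increment from [A] to the union of [A] and [B] is nonnegative and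
    approximates [s] minus the partial sum over [A]. *)
Lemma partial_sum_le_has_sum A : summability.partial_sum x A <= s.
Proof.
rewrite -subr_ge0; apply: eps_ge0 => e e0.
have [B sB] := has_sum_scalar_near e0.
exists (summability.partial_sum x (A `|` B)%fset - summability.partial_sum x A).
  by rewrite partial_sum_setD ?fsubsetUl// partial_sumE sumr_ge0.
rewrite opprB addrA subrK ltW//; apply: sB; exact: fsubsetUr.
Qed.

End HasSum.

(** * Convergence, linearity and boundedness of the frame operator of a pair *)

Section FrameOperator.
Variables (R : realType) (k : scalar_kind).
Local Notation K := (scalars R k).
Variables (I : choiceType) (H : hilbert R k) (Hj : I -> hilbert R k).
Implicit Types (f g : H) (A B : {fset I}).

Lemma gf_quad_ge0 (F : gfusion_family H Hj) T f i : 0 <= gf_quad F T f i.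
Proof.
by rewrite mulr_ge0// -?inner_norm exprn_ge0// ltW// gf_weight_gt0.
Qed.

Lemma gf_image_linear (F : gfusion_family H Hj) T i :
  linear T -> linear (gf_image F T i).
Proof.
move=> lT a f g; have [lF _] := gf_op_bounded F i.
by rewrite /gf_image lT (orth_proj_linear (gf_space_closed F i)) lF.
Qed.

Variables (F G : gfusion_family H Hj) (T U : H -> H).
Hypotheses (T_bounded : bounded_linear T) (U_bounded : bounded_linear U).
Variables (bF bG : K).
Hypotheses (bF_gt0 : 0 < bF) (bG_gt0 : 0 < bG).
Hypothesis (F_bessel : forall f, exists2 s : K,
  has_sum (gf_quad F T f : I -> K^o) s & s <= bF * `|f| ^+ 2).
Hypothesis (G_bessel : forall f, exists2 s : K,
  has_sum (gf_quad G U f : I -> K^o) s & s <= bG * `|f| ^+ 2).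

Definition frame_term f (j : I) : H := (gf_weight G j * gf_weight F j) *:
    adjoint U (orth_proj (gf_space G j)
      (adjoint (gf_op G j) (gf_image F T j f))).

Local Notation fsum f := (summability.partial_sum (frame_term f)).
Local Notation qsum f := (summability.partial_sum (gf_quad F T f)).

Lemma inner_frame_term f g j : '[frame_term f j, g] =
  (gf_weight G j * gf_weight F j) * '[gf_image F T j f, gf_image G U j g].
Proof.
rewrite innerZl adjointPr// orth_proj_sym; last exact: gf_space_closed.
by rewrite adjointPr//; exact: gf_op_bounded.
Qed.

(** Tested against every [h], the claim reduces to linearity of [gf_image]; the adjoints
    disappear. *)
Lemma frame_term_linear (a : K) f g j :
  frame_term (a *: f + g) j = a *: frame_term f j + frame_term g j.
Proof.
apply: inner_ext => h; rewrite [LHS]inner_frame_term [RHS]innerDl innerZl.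
rewrite 2!inner_frame_term.
rewrite gf_image_linear; last by case: T_bounded.
by rewrite innerDl innerZl mulrDr mulrCA.
Qed.

(** Each term is bounded by Cauchy-Schwarz in [Hj j] and then by [amgm2], applied to the weighted
    norms of the two images. The Bessel bound of [G] absorbs the partial sum in [g]. *)
Lemma inner_frame_sum_le f g A (t : K) : 0 < t ->
  2 * `|'[fsum f A, g]| <= t^-1 * qsum f A + t * (bG * `|g| ^+ 2).
Proof.
move=> t0; have [s gs sle] := G_bessel g.
have gA := partial_sum_le_has_sum (gf_quad_ge0 G U g) gs A.
apply: (@le_trans _ _ (t^-1 * qsum f A +
    t * summability.partial_sum (gf_quad G U g) A)); last first.
  by rewrite lerD2l ler_pM2l// (le_trans gA).
rewrite !partial_sumE inner_suml.
apply: le_trans (ler_wpM2l _ (ler_norm_sum _ _ _)) _ => //.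
rewrite !mulr_sumr -big_split/=; apply: ler_sum => j _.
have wF := gf_weight_gt0 F j; have wG := gf_weight_gt0 G j.
rewrite inner_frame_term /gf_quad -!inner_norm -!exprMn.
apply: le_trans (amgm2 _ _ t0); rewrite ?mulr_ge0 ?(ltW wF) ?(ltW wG)//.
rewrite ler_wpM2l// normrM ger0_norm; last by rewrite mulr_ge0 ?ltW.
rewrite [X in _ <= X]mulrACA [gf_weight F j * _]mulrC ler_wpM2l//.
  by rewrite mulr_ge0 ?ltW.
exact: cauchy_schwarz.
Qed.

Lemma norm_frame_sum_le f A : `|fsum f A| ^+ 2 <= bG * qsum f A.
Proof.
(* With this [t] the last term is [|fsum f A| ^+ 2] and cancels one of the two copies on the
   left. *)
have := @inner_frame_sum_le f (fsum f A) A bG^-1.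
rewrite invr_gt0 => /(_ bG_gt0).
rewrite -inner_norm invrK mulKf ?gt_eqF// ger0_norm ?exprn_ge0//.
by rewrite mulr_natl mulr2n lerD2r.
Qed.

Lemma frame_operatorP f :
  summability.partial_sum (frame_term f) @ summability.totally
    --> frame_operator G U F T f.
Proof.
have [s fs _] := F_bessel f.
(* [frame_operator] is by definition the limit of this filter, so by completeness the Cauchy
   property suffices. *)
apply: (@cauchy_cvg _ (fsum f @ summability.totally)).
apply: cauchy_exP => e e0.
(* A tail of the quadratic form below [e ^+ 2 / bG] gives, by [norm_frame_sum_le], a tail of norm
   below [e]. *)
have d0 : 0 < e ^+ 2 / bG by rewrite divr_gt0// exprn_gt0.
have [A sA] := has_sum_scalar_near fs d0.
exists (fsum f A); exists A => // B /= AB.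
rewrite -ball_normE/= distrC -ltr_sqr ?nnegrE ?(ltW e0)//.
rewrite partial_sum_setD// (le_lt_trans (norm_frame_sum_le _ _))//.
rewrite mulrC -ltr_pdivlMr// -partial_sum_setD//.
have qle B' := partial_sum_le_has_sum (gf_quad_ge0 F T f) fs B'.
have := sA _ (fsubset_refl A); rewrite ger0_norm ?subr_ge0//.
by apply: le_lt_trans; rewrite lerD2r.
Qed.

Lemma frame_operator_linear : linear (frame_operator G U F T).
Proof.
move=> a f g; apply: (@cvg_unique _ (@norm_hausdorff _ H)
  (fsum (a *: f + g) @ summability.totally)).
- exact: frame_operatorP.
- have -> : fsum (a *: f + g) = (fun A => a *: fsum f A + fsum g A).
    apply/funext => A; rewrite /summability.partial_sum scaler_sumr -big_split.
    by apply: eq_bigr => j _; exact: frame_term_linear.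
  by apply: cvgD; [apply: cvgZr|]; exact: frame_operatorP.
Qed.

(** The bound for partial sums passes to the limit through [eps_ge0_mul]: replacing the operator by
    a partial sum within [e] changes the left side by at most [e * (2 * |g|)]. *)
Lemma inner_frame_operator_le f g (s t : K) : 0 < t ->
  has_sum (gf_quad F T f : I -> K^o) s ->
  2 * `|'[frame_operator G U F T f, g]| <= t^-1 * s + t * (bG * `|g| ^+ 2).
Proof.
move=> t0 fs; rewrite -subr_ge0.
apply: (@eps_ge0_mul _ _ (2 * `|g|)) => [|e e0]; first by rewrite mulr_ge0.
have [A SA] := has_sum_near (@frame_operatorP f) e0.
exists (t^-1 * s + t * (bG * `|g| ^+ 2) - 2 * `|'[fsum f A, g]|).
  rewrite subr_ge0 (le_trans (inner_frame_sum_le _ _ _ t0))// lerD2r.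
  rewrite ler_pM2l ?invr_gt0//.
  exact: partial_sum_le_has_sum (gf_quad_ge0 F T f) fs A.
rewrite opprB addrC addrA subrK -mulrBr normrM ger0_norm// [e * _]mulrCA.
rewrite ler_wpM2l// (le_trans (ler_dist_dist _ _))// -innerBl.
by apply: norm_inner_le_l; rewrite distrC ltW// SA.
Qed.

Lemma frame_operator_bounded : bounded_linear (frame_operator G U F T).
Proof.
split; first exact: frame_operator_linear.
(* The estimate obtained is [|S f|^2 <= bG * bF * |f|^2]; since [x <= (x + 1)^2] for [x >= 0], this
   constant avoids a square root. *)
exists (bG * bF + 1) => f; have [s fs sle] := F_bessel f.
have bb : 0 <= bG * bF by rewrite mulr_ge0// ltW.
rewrite -ler_sqr ?nnegrE ?mulr_ge0 ?addr_ge0// exprMn.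
have := @inner_frame_operator_le f (frame_operator G U F T f) s bG^-1.
rewrite invr_gt0 => /(_ bG_gt0 fs).
rewrite -inner_norm invrK mulKf ?gt_eqF// ger0_norm ?exprn_ge0//.
rewrite mulr_natl mulr2n lerD2r => /le_trans -> //.
apply: (@le_trans _ _ (bG * (bF * `|f| ^+ 2))); first by rewrite ler_pM2l.
rewrite mulrA ler_wpM2r ?exprn_ge0// sqrrD1 -addrA ler_wpDl ?exprn_ge0//.
by rewrite ler_wpDr// mulr2n lerDl.
Qed.

End FrameOperator.

(** * The frame operator of a family paired with itself *)

Section DiagonalFrameOperator.
Variables (R : realType) (k : scalar_kind).
Local Notation K := (scalars R k).
Variables (I : choiceType) (H : hilbert R k) (Hj : I -> hilbert R k).
Implicit Types (f g : H) (A : {fset I}).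
Variables (F : gfusion_family H Hj) (T : H -> H).
Hypotheses (T_bounded : bounded_linear T) (b : K) (b_gt0 : 0 < b).
Hypothesis (F_bessel : forall f, exists2 s : K,
  has_sum (gf_quad F T f : I -> K^o) s & s <= b * `|f| ^+ 2).

Local Notation S := (frame_operator F T F T).
Local Notation fsum f := (summability.partial_sum (frame_term F F T T f)).

Let SP f : fsum f @ summability.totally --> S f.
Proof. exact: (frame_operatorP T_bounded b_gt0 F_bessel F_bessel). Qed.

(** Each term is a positive weight times [<F f, F g>], where [F] stands for the [j]-th image map;
    exchanging [f] and [g] conjugates it. *)
Lemma frame_sum_sym f g A : '[fsum f A, g] = '[f, fsum g A].
Proof.
rewrite (innerC f) 2!partial_sumE 2!inner_suml.
have conj_sum (r : seq I) (x : I -> K) :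
    scalar_conj (\sum_(j <- r) x j) = \sum_(j <- r) scalar_conj (x j).
  elim/big_rec2 : _ => [|j y z _ <-]; first exact: ger0_scalar_conj.
  exact: scalar_conjD.
rewrite conj_sum; apply: eq_bigr => j _.
rewrite !inner_frame_term// scalar_conjM -innerC ger0_scalar_conj//.
by rewrite mulr_ge0// ltW// gf_weight_gt0.
Qed.

Lemma frame_operator_self_adjoint : self_adjoint S.
Proof.
apply: self_adjointP => [|f g].
  exact: (frame_operator_bounded T_bounded T_bounded b_gt0 b_gt0 F_bessel F_bessel).
apply/eqP; rewrite -subr_eq0; apply/eqP.
apply: (@eps_eq0_mul _ _ (`|f| + `|g|)) => [|e e0]; first exact: addr_ge0.
have [A SA] := has_sum_near (@SP f) e0; have [B SB] := has_sum_near (@SP g) e0.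
(* Symmetry holds for one and the same finite set, so both limits are approximated over the
   union. *)
have {}SA := SA _ (fsubsetUl A B); have {}SB := SB _ (fsubsetUr A B).
have -> : '[S f, g] - '[f, S g] =
    '[S f - fsum f (A `|` B)%fset, g] - '[f, S g - fsum g (A `|` B)%fset].
  by rewrite innerBl innerBr frame_sum_sym opprB addrA subrK.
apply: le_trans (ler_normB _ _) _; rewrite mulrDr addrC lerD//.
- exact: norm_inner_le_r (ltW SB).
- exact: norm_inner_le_l (ltW SA).
Qed.

Lemma inner_frame_operator_diag f (s : K) :
  has_sum (gf_quad F T f : I -> K^o) s -> '[S f, f] = s.
Proof.
move=> fs; apply/eqP; rewrite -subr_eq0; apply/eqP.
(* The summand [|f|] pays for approximating the operator, and [1] for approximating the scalar
   sum. *)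
apply: (@eps_eq0_mul _ _ (`|f| + 1)) => [|e e0]; first by rewrite addr_ge0.
have [A SA] := has_sum_near (@SP f) e0.
have [B sB] := has_sum_scalar_near fs e0.
have {}SA := SA _ (fsubsetUl A B); have {}sB := sB _ (fsubsetUr A B).
have sumE : '[fsum f (A `|` B)%fset, f] =
    summability.partial_sum (gf_quad F T f) (A `|` B)%fset.
  rewrite !partial_sumE inner_suml; apply: eq_bigr => j _.
  by rewrite inner_frame_term.
have -> : '[S f, f] - s = '[S f - fsum f (A `|` B)%fset, f] -
    (s - summability.partial_sum (gf_quad F T f) (A `|` B)%fset).
  by rewrite innerBl sumE opprB addrA subrK.
apply: le_trans (ler_normB _ _) _; rewrite mulrDr mulr1 lerD//; last exact: ltW.
by apply: norm_inner_le_l; exact: ltW.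
Qed.

End DiagonalFrameOperator.

(** * Controlled frames characterized by a lower bound on the operator of a pair *)

Theorem theorem4p4 (R : realType) (k : scalar_kind) (H : hilbert R k)
    (H_separable : separable H) (J : set int) (Hj : J -> hilbert R k)
    (T : H -> H) (T_inv : boundedly_invertible T)
    (Lambda : gfusion_family H Hj) (Lambda_bessel : controlled_bessel Lambda T) :
  controlled_frame Lambda T <->
  exists U : H -> H, boundedly_invertible U /\
    exists Gamma : gfusion_family H Hj, controlled_bessel Gamma U /\
      exists2 m : scalars R k, 0 < m &
        op_le (fun f : H => m *: f) (frame_operator Gamma U Lambda T).
Proof.
have [b b0 Fb] := Lambda_bessel; have [bT _] := T_inv.
split=> [[a [b' [a0 _ Fa]]]|[U [[bU _] [G [[c c0 Gc] [m m0 [_ _ mle]]]]]]].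
  (* The pair of [Lambda] with itself works, with [m] the lower frame bound [a]. *)
  exists T; split=> //; exists Lambda; split=> //; exists a => //; split.
  - by apply: scale_self_adjoint; exact: ltW.
  - exact: frame_operator_self_adjoint b0 Fb.
  - move=> f; have [s fs /andP[ale _]] := Fa f.
    by rewrite (inner_frame_operator_diag bT b0 Fb fs) innerZl -inner_norm.
have a0 : 0 < m ^+ 2 / c by rewrite divr_gt0 ?exprn_gt0.
(* Enlarging the upper bound [b] keeps the two bounds ordered even when [H] is the zero space. *)
exists (m ^+ 2 / c), (b + m ^+ 2 / c); split=> [//||f].
  by rewrite lerDr ltW.
have [s fs sle] := Fb f; exists s => //; apply/andP; split; last first.
  by rewrite (le_trans sle)// ler_wpM2r ?exprn_ge0// lerDl ltW.
(* With this [t] the estimate reads [2 m |f|^2 <= (c / m) s + m |f|^2]. *)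
have t0 : 0 < m / c by rewrite divr_gt0.
have := inner_frame_operator_le bU c0 Fb Gc f t0 fs.
have := mle f; rewrite innerZl -inner_norm => mS.
have mf : 0 <= m * `|f| ^+ 2 by rewrite mulr_ge0 ?exprn_ge0// ltW.
rewrite ger0_norm ?(le_trans mf)// => /(le_trans (ler_wpM2l _ mS)).
rewrite mulrA divfK ?gt_eqF// mulr_natl mulr2n lerD2r => /(_ (ler0n _ 2)).
rewrite invf_div mulrAC ler_pdivlMr// => h.
by rewrite mulrAC ler_pdivrMr// (mulrC s) expr2 (mulrAC m).
Qed.
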